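(* Let $p,q$ be CCS processes with $p\approx q$. Then at least one of the following holds: (1) there is $p'$ such that $p\xrightarrow{\tau}p'$ and $p'\approx q$; (2) there is $q'$ such that $q\xrightarrow{\tau}q'$ and $p\approx q'$; (3) $p\approx^c q$.
   Context: Processes. Let $\alpha$ and $\beta$ be nonempty sets. Labels are $\mathrm{name}(b)$ and $\mathrm{coname}(b)$ for $b\in\beta$; the complement $\overline{\cdot}$ exchanges $\mathrm{name}(b)$ and $\mathrm{coname}(b)$. Actions are $\tau$ and the labels. CCS processes are the terms freely generated by: $\mathrm{nil}$; variables (constants) $X\in\alpha$; $u.E$ ($u$ an action); $E+E'$; $E\,||\,E'$; $\nu L\,E$ ($L$ a set of labels); $\mathrm{relab}(E,f)$ ($f$ a function from labels to labels commuting with complement, extended to actions by $f(\tau)=\tau$); $\mathrm{rec}\,X.E$. The transition relation $E\xrightarrow{u}E'$ is the least relation such that: $u.E\xrightarrow{u}E$; if $E\xrightarrow{u}E_1$ then $E+E'\xrightarrow{u}E_1$ and $E'+E\xrightarrow{u}E_1$; if $E\xrightarrow{u}E_1$ then $E||E'\xrightarrow{u}E_1||E'$ and $E'||E\xrightarrow{u}E'||E_1$; if $E\xrightarrow{l}E_1$ and $E'\xrightarrow{\overline{l}}E_2$ for a label $l$ then $E||E'\xrightarrow{\tau}E_1||E_2$; if $E\xrightarrow{u}E_1$ and either $u=\tau$ or $u$ is a label with $u,\overline{u}\notin L$, then $\nu L\,E\xrightarrow{u}\nu L\,E_1$; if $E\xrightarrow{u}E_1$ then $\mathrm{relab}(E,f)\xrightarrow{f(u)}\mathrm{relab}(E_1,f)$;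 if $E\{\mathrm{rec}\,X.E/X\}\xrightarrow{u}E_1$ then $\mathrm{rec}\,X.E\xrightarrow{u}E_1$ (the substitution replaces the occurrences of $X$ not under a binder $\mathrm{rec}\,X$). Weak notions. $E\overset{\epsilon}{\Rightarrow}E'$ is the reflexive transitive closure of $\xrightarrow{\tau}$. For any action $u$ (including $\tau$), $E\overset{u}{\Rightarrow}E'$ means there are $E_1,E_2$ with $E\overset{\epsilon}{\Rightarrow}E_1\xrightarrow{u}E_2\overset{\epsilon}{\Rightarrow}E'$. A relation $W$ on processes is a weak bisimulation if whenever $W\,E\,E'$: for each label $l$, $E\xrightarrow{l}E_1$ implies there is $E_2$ with $E'\overset{l}{\Rightarrow}E_2$ and $W\,E_1\,E_2$, and $E'\xrightarrow{l}E_2$ implies there is $E_1$ with $E\overset{l}{\Rightarrow}E_1$ and $W\,E_1\,E_2$; and $E\xrightarrow{\tau}E_1$ implies there is $E_2$ with $E'\overset{\epsilon}{\Rightarrow}E_2$ and $W\,E_1\,E_2$, and $E'\xrightarrow{\tau}E_2$ implies there is $E_1$ with $E\overset{\epsilon}{\Rightarrow}E_1$ and $W\,E_1\,E_2$. Weak equivalence: $E\approx E'$ iff $W\,E\,E'$ for some weak bisimulation $W$. Observation congruence: $E\approx^c E'$ iff for every action $u$ (including $\tau$): for every $E_1$ with $E\xrightarrow{u}E_1$ there is $E_2$ with $E'\overset{u}{\Rightarrow}E_2$ and $E_1\approx E_2$; and for every $E_2$ with $E'\xrightarrow{u}E_2$ there is $E_1$ with $E\overset{u}{\Rightarrow}E_1$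 and $E_1\approx E_2$. *)

(* Defs.v *)
From Stdlib Require Import Relations Ensembles ClassicalEpsilon.

Set Implicit Arguments.

Inductive label (beta : Type) : Type :=
| name (b : beta)
| coname (b : beta).

Definition compl (beta : Type) (l : label beta) : label beta :=
  match l with
  | name b => coname b
  | coname b => name b
  end.

Inductive action (beta : Type) : Type :=
| tau
| act (l : label beta).

Arguments tau {beta}.

Record relabeling (beta : Type) : Type := Relabeling {
  relab_fun :> label beta -> label beta;
  relab_compl : forall l, relab_fun (compl l) = compl (relab_fun l)
}.

Definition relab_action (beta : Type) (f : relabeling beta) (u : action beta)
    : action beta :=
  match u with
  | tau => tau
  | act l => act (f l)
  end.

Inductive CCS (alpha beta : Type) : Type :=
| nil
| var (X : alpha)
| prefix (u : action beta) (E : CCS alpha beta)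
| sum (E E' : CCS alpha beta)
| par (E E' : CCS alpha beta)
| restr (L : Ensemble (label beta)) (E : CCS alpha beta)
| relab (E : CCS alpha beta) (f : relabeling beta)
| rec (X : alpha) (E : CCS alpha beta).

Arguments nil {alpha beta}.
Arguments var {alpha beta}.

(* [subst F X E] is E{F/X}.  It is not capture-avoiding: free variables of [F]
   may become bound.  Since [alpha] is an arbitrary type, variables are compared
   using classical logic. *)
Fixpoint subst (alpha beta : Type) (F : CCS alpha beta) (X : alpha)
    (E : CCS alpha beta) : CCS alpha beta :=
  match E with
  | nil => nil
  | var Y => if excluded_middle_informative (Y = X) then F else var Y
  | prefix u E1 => prefix u (subst F X E1)
  | sum E1 E2 => sum (subst F X E1) (subst F X E2)
  | par E1 E2 => par (subst F X E1) (subst F X E2)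
  | restr L E1 => restr L (subst F X E1)
  | relab E1 f => relab (subst F X E1) f
  | rec Y E1 =>
      if excluded_middle_informative (Y = X) then rec Y E1
      else rec Y (subst F X E1)
  end.

Inductive trans (alpha beta : Type) :
    CCS alpha beta -> action beta -> CCS alpha beta -> Prop :=
| trans_prefix u E : trans (prefix u E) u E
| trans_sum_l u E E' E1 : trans E u E1 -> trans (sum E E') u E1
| trans_sum_r u E E' E1 : trans E u E1 -> trans (sum E' E) u E1
| trans_par_l u E E' E1 : trans E u E1 -> trans (par E E') u (par E1 E')
| trans_par_r u E E' E1 : trans E u E1 -> trans (par E' E) u (par E' E1)
| trans_par_sync l E E' E1 E2 :
    trans E (act l) E1 -> trans E' (act (compl l)) E2 ->
    trans (par E E') tau (par E1 E2)
| trans_restr u L E E1 :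
    trans E u E1 ->
    u = tau \/
      (exists l, u = act l /\ ~ In _ L l /\ ~ In _ L (compl l)) ->
    trans (restr L E) u (restr L E1)
| trans_relab u E f E1 :
    trans E u E1 -> trans (relab E f) (relab_action f u) (relab E1 f)
| trans_rec u X E E1 :
    trans (subst (rec X E) X E) u E1 -> trans (rec X E) u E1.

Definition eps_trans (alpha beta : Type) : relation (CCS alpha beta) :=
  clos_refl_trans _ (fun E E' => trans E tau E').

(* For [u = tau] this requires at least one tau-step, unlike [eps_trans]. *)
Definition weak_trans (alpha beta : Type) (E : CCS alpha beta)
    (u : action beta) (E' : CCS alpha beta) : Prop :=
  exists E1 E2, eps_trans E E1 /\ trans E1 u E2 /\ eps_trans E2 E'.

Definition weak_bisimulation (alpha beta : Type)
    (W : relation (CCS alpha beta)) : Prop :=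
  forall E E', W E E' ->
    (forall l : label beta,
      (forall E1, trans E (act l) E1 ->
        exists E2, weak_trans E' (act l) E2 /\ W E1 E2) /\
      (forall E2, trans E' (act l) E2 ->
        exists E1, weak_trans E (act l) E1 /\ W E1 E2)) /\
    (forall E1, trans E tau E1 -> exists E2, eps_trans E' E2 /\ W E1 E2) /\
    (forall E2, trans E' tau E2 -> exists E1, eps_trans E E1 /\ W E1 E2).

Definition weak_equiv (alpha beta : Type) (E E' : CCS alpha beta) : Prop :=
  exists W : relation (CCS alpha beta), weak_bisimulation W /\ W E E'.

Definition obs_congr (alpha beta : Type) (E E' : CCS alpha beta) : Prop :=
  forall u : action beta,
    (forall E1, trans E u E1 ->
      exists E2, weak_trans E' u E2 /\ weak_equiv E1 E2) /\
    (forall E2, trans E' u E2 ->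
      exists E1, weak_trans E u E1 /\ weak_equiv E1 E2).

(* Main.v *)
(* If neither (1) nor (2) holds, a tau-move of one process cannot be matched by
   the other staying put, so every matching eps-transition contains a tau-step
   and the weak bisimulation game already satisfies the rooted condition. *)
Require Import Defs.
From Stdlib Require Import Relations Classical.

(** The step-first form [clos_refl_trans_1n] of the closure exposes the initial tau-step of a
    nonempty path. *)
Lemma eps_trans_inv (alpha beta : Type) (E E' : CCS alpha beta) :
  eps_trans E E' -> E = E' \/ weak_trans E tau E'.
Proof.
  intros H. apply clos_rt_rt1n in H. destruct H as [|E1 E' Hstep Hrest].
  - now left.
  - right. exists E, E1. repeat split.
    + apply rt_refl.
    + exact Hstep.
    + now apply clos_rt1n_rt.
Qed.

(** Each witnessing [W] is contained in [weak_equiv], so a match found in [W] also serves here. *)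
Lemma weak_equiv_weak_bisimulation (alpha beta : Type) :
  weak_bisimulation (@weak_equiv alpha beta).
Proof.
  intros E E' [W [bisim HW]].
  assert (sub : forall F F', W F F' -> weak_equiv F F')
    by (intros F F' HF; now exists W).
  destruct (bisim E E' HW) as [Hact [Htau_l Htau_r]].
  repeat split.
  - intros E1 H. destruct (Hact l) as [Hl _].
    destruct (Hl E1 H) as [E2 [? ?]]. eauto.
  - intros E2 H. destruct (Hact l) as [_ Hr].
    destruct (Hr E2 H) as [E1 [? ?]]. eauto.
  - intros E1 H. destruct (Htau_l E1 H) as [E2 [? ?]]. eauto.
  - intros E2 H. destruct (Htau_r E2 H) as [E1 [? ?]]. eauto.
Qed.

Theorem theorem8 (alpha beta : Type)
    (alpha_nonempty : inhabited alpha) (beta_nonempty : inhabited beta)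
    (p q : CCS alpha beta) (pq : weak_equiv p q) :
  (exists p' : CCS alpha beta, trans p tau p' /\ weak_equiv p' q) \/
  (exists q' : CCS alpha beta, trans q tau q' /\ weak_equiv p q') \/
  obs_congr p q.
Proof.
  destruct (classic (exists p' : CCS alpha beta, trans p tau p' /\ weak_equiv p' q))
    as [|no_p]; [now left|].
  destruct (classic (exists q' : CCS alpha beta, trans q tau q' /\ weak_equiv p q'))
    as [|no_q]; [now right; left|].
  right; right.
  destruct (weak_equiv_weak_bisimulation _ _ _ _ pq) as [Hact [Htau_l Htau_r]].
  (* For labels, the clauses of [obs_congr] and of [weak_bisimulation] at [weak_equiv] coincide;
     only [tau] remains. *)
  intros [|l]; [|exact (Hact l)].
  split.
  - intros E1 H. destruct (Htau_l E1 H) as [E2 [Heps Heq]].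
    destruct (eps_trans_inv _ _ _ _ Heps) as [<-|Hweak].
    (* Here [q] stayed put, so [E1] is a tau-derivative of [p] equivalent to [q], against [no_p]. *)
    + exfalso. eauto.
    + eauto.
  - intros E2 H. destruct (Htau_r E2 H) as [E1 [Heps Heq]].
    destruct (eps_trans_inv _ _ _ _ Heps) as [<-|Hweak].
    + exfalso. eauto.
    + eauto.
Qed.
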